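(* Let $p$ be a prime congruent to $5$ or $11$ modulo $12$. Then the set $$\left\{\frac{3^34^4(2a-1)^3}{a(a+4)^3}\ \Bigm|\ a^{(p+1)/3}+2^{1/3}=0,\ a\in\mathbb{F}_{p^2}\right\}\setminus\{0,1728\}$$ coincides with the set of $j$-invariants of the elliptic curves $$\mathcal{E}_b:\ X^3+Y^3+1=3bXY,$$ whenever it is non-singular, with $b\in\mathbb{F}_{p^2}$ satisfying $b^{p+1}\equiv-2 \bmod p$ (that is, $b^{p+1}=-2$ in $\mathbb{F}_{p^2}$).
   Context: Since $p\equiv2\pmod 3$, every element of $\mathbb{F}_p$ has a unique cube root in $\mathbb{F}_p$; $2^{1/3}$ denotes the unique cube root of $2$ in $\mathbb{F}_p$. The equation of $\mathcal{E}_b$ is the affine equation of a plane projective cubic over $\mathbb{F}_{p^2}$ (a Hessian curve), and $j$-invariants are normalized as usual (so that $Y^2=X^3+X$ has $j$-invariant $1728$).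
   Formalization: For p ≡ 5 mod 12 the value 1728 is also removed from the set of j-invariants of the curves E_b, because b = 1+√3 has b^{p+1} = −2 and gives a non-singular curve with j = 1728; for p ≡ 11 mod 12 the equality is proved as stated. *)

(* Defs.v *)
From HB Require Import structures.
From mathcomp Require Import all_boot all_order all_algebra all_field.
From mathcomp Require Import mpoly zify.

Set Implicit Arguments.
Unset Strict Implicit.
Unset Printing Implicit Defensive.

Import GRing.Theory.
Local Open Scope ring_scope.

(* The defining property is only guaranteed when p = 2 %[mod 3]; see cbrtP. *)
Definition cbrt (p : nat) (c : 'F_p) : 'F_p :=
  odflt 0 [pick r : 'F_p | r ^+ 3 == c].

Lemma cbrtP (p : nat) (c : 'F_p) : prime p -> p = 2 %[mod 3] ->
  forall r : 'F_p, r ^+ 3 = c <-> r = cbrt c.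
Proof.
move=> p_pr p3.
have fermat (x : 'F_p) : x ^+ p = x.
  by have := expf_card x; rewrite card_Fp.
set m := ((p %/ 3).*2 + 1)%N.
have mE : (3 * m + 1 = p + p)%N.
  by rewrite [in RHS](divn_eq p 3) p3 /m; lia.
have cubeK (x : 'F_p) : (x ^+ 3) ^+ m = x.
  have [->|x0] := eqVneq x 0; first by rewrite -exprM expr0n /m addn1.
  apply: (mulIf x0).
  by rewrite -exprM -exprSr -addn1 mE exprD fermat.
have cubeVK (x : 'F_p) : (x ^+ m) ^+ 3 = x by rewrite -exprM mulnC exprM cubeK.
move=> r; rewrite /cbrt; case: pickP => [s /eqP sE|none] /=; last first.
  by have := none (c ^+ m); rewrite cubeVK eqxx.
split=> [rE|->//]; by rewrite -(cubeK r) rE -sE cubeK.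
Qed.

Section PlaneCubics.
Variable K : fieldType.

Definition hom_x : {mpoly K[3]} := 'X_(inord 0).
Definition hom_y : {mpoly K[3]} := 'X_(inord 1).
Definition hom_z : {mpoly K[3]} := 'X_(inord 2).

(* Singular points are looked for over every extension field of K. *)
Definition nonsingular (F : {mpoly K[3]}) : Prop :=
  forall (L : fieldType) (f : {rmorphism K -> L}) (v : 'I_3 -> L),
    (exists i, v i != 0) -> (map_mpoly f F).@[v] = 0 ->
    exists i, (map_mpoly f F^`M(i)).@[v] != 0.

(* Weierstrass equation Y^2 + a1 XY + a3 Y = X^3 + a2 X^2 + a4 X + a6. *)
Record weierstrass := Weierstrass
  { wa1 : K; wa2 : K; wa3 : K; wa4 : K; wa6 : K }.

Definition weierstrass_poly (w : weierstrass) : {mpoly K[3]} :=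
  hom_y ^+ 2 * hom_z + wa1 w *: (hom_x * hom_y * hom_z)
    + wa3 w *: (hom_y * hom_z ^+ 2)
  - (hom_x ^+ 3 + wa2 w *: (hom_x ^+ 2 * hom_z)
     + wa4 w *: (hom_x * hom_z ^+ 2) + wa6 w *: hom_z ^+ 3).

Definition wb2 w := wa1 w ^+ 2 + 4%:R * wa2 w.
Definition wb4 w := 2%:R * wa4 w + wa1 w * wa3 w.
Definition wb6 w := wa3 w ^+ 2 + 4%:R * wa6 w.
Definition wb8 w :=
  wa1 w ^+ 2 * wa6 w + 4%:R * wa2 w * wa6 w - wa1 w * wa3 w * wa4 w
  + wa2 w * wa3 w ^+ 2 - wa4 w ^+ 2.
Definition wc4 w := wb2 w ^+ 2 - 24%:R * wb4 w.
Definition wdisc w :=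
  - wb2 w ^+ 2 * wb8 w - 8%:R * wb4 w ^+ 3 - 27%:R * wb6 w ^+ 2
  + 9%:R * wb2 w * wb4 w * wb6 w.

Definition weierstrass_j w := wc4 w ^+ 3 / wdisc w.

Definition linear_subst (A : 'M[K]_3) : 3.-tuple {mpoly K[3]} :=
  [tuple \sum_j A i j *: 'X_j | i < 3].

(* j is the j-invariant of the plane cubic F = 0: the latter has a            *)
(* nonsingular Weierstrass model with that j-invariant.  A projective change  *)
(* of coordinates over K suffices to reach such a model as soon as F has a    *)
(* K-rational flex; the cubics hessian_cubic b all have the flex (1 : -1 : 0).*)
Definition is_j_invariant (F : {mpoly K[3]}) (j : K) : Prop :=
  exists (w : weierstrass) (A : 'M[K]_3) (c : K),
    [/\ A \in unitmx, c != 0, wdisc w != 0,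
        F \mPo (linear_subst A) = c *: weierstrass_poly w
      & j = weierstrass_j w].

Definition hessian_cubic (b : K) : {mpoly K[3]} :=
  hom_x ^+ 3 + hom_y ^+ 3 + hom_z ^+ 3 - (3%:R * b) *: (hom_x * hom_y * hom_z).

End PlaneCubics.

(* An element of 'F_p is sent to the prime subfield of K through its          *)
(* representative in nat.  The denominator never vanishes for p > 3.          *)
Definition param_j (p : nat) (K : fieldType) (j : K) : Prop :=
  exists a : K,
    a ^+ ((p + 1) %/ 3) + (cbrt (2%:R : 'F_p) : nat)%:R = 0 /\
    j = 3%:R ^+ 3 * 4%:R ^+ 4 * (2%:R * a - 1) ^+ 3 / (a * (a + 4%:R) ^+ 3).

(* For p = 5 %[mod 12] this set contains 1728, reached at b = 1 + sqrt 3.     *)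
Definition hessian_j (p : nat) (K : fieldType) (j : K) : Prop :=
  exists b : K, [/\ b ^+ (p + 1) = - 2%:R, nonsingular (hessian_cubic b)
                  & is_j_invariant (hessian_cubic b) j].

(* Main.v *)
Require Import Defs.
From mathcomp Require Import all_boot all_order all_algebra all_field.
From mathcomp Require Import mpoly ring zify.

(* The j-invariant of X^3 + Y^3 + 1 = 3bXY is 27 t (t + 8)^3 / (t - 1)^3 with
   t = b^3, and t = -4/a turns this into the expression in a of the statement.
   Write p + 1 = 3m; m is even and c := 2^(1/3) satisfies 4^m = 2c, because
   both sides lie in F_p, where cubing is injective.  Hence b^(p+1) = t^m = -2
   amounts to a^m = -c, and conversely t^m = -2 makes t a cube in F_(p^2).
   The value j = 0 is never reached, since b^3 = -8 would give b^(p+1) = 4.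
   If j = 1728, then b^3 = u^3 with u = 1 + s and s^2 = 3; for p = 11 mod 12
   both s and u lie in F_p, so u^2 = u^(p+1) = b^(p+1) = -2, a contradiction.
   That the j-invariant of the plane cubic is well defined is read off from the
   invariants c4 and c6 of ternary cubics: a linear substitution A multiplies
   them by det(A)^4 and det(A)^6. *)

Set Implicit Arguments.
Unset Strict Implicit.
Unset Printing Implicit Defensive.
Import GRing.Theory.
Local Open Scope ring_scope.

(** * Ternary cubics as coefficient records, and their invariants *)

Record cubic (K : fieldType) := Cubic
  { c300 : K; c030 : K; c003 : K; c210 : K; c201 : K;
    c120 : K; c021 : K; c102 : K; c012 : K; c111 : K }.

Section PlaneCubicInvariants.
Variable K : fieldType.
Implicit Types u v : cubic K.

(* b2, b4, b6 of the Weierstrass equation given by Artin, Rodriguez-Villegas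
   and Tate for the Jacobian of a plane cubic; they are not invariants, only
   the combinations c4 and c6 are. *)
Definition cubic_b2 u :=
  let: Cubic a b c a2 a3 b1 b3 c1 c2 m := u in
  m ^+ 2 - 4%:R * (a2 * c2 + a3 * b3 + b1 * c1).

Definition cubic_b4 u :=
  let: Cubic a b c a2 a3 b1 b3 c1 c2 m := u in
  - m * (a * b3 * c2 + b * a3 * c1 + c * a2 * b1 + a2 * b3 * c1
         + a3 * b1 * c2)
  + 9%:R * m * a * b * c
  + 2%:R * (a * b1 * c2 ^+ 2 + a * b3 ^+ 2 * c1 + b * a2 * c1 ^+ 2
            + b * a3 ^+ 2 * c2 + c * a2 ^+ 2 * b3 + c * a3 * b1 ^+ 2
            + a2 * a3 * b3 * c2 + a2 * b1 * c1 * c2 + a3 * b1 * b3 * c1)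
  - 6%:R * (a * b * c1 * c2 + a * c * b1 * b3 + b * c * a2 * a3).

Definition cubic_b6 u :=
  let: Cubic a b c a2 a3 b1 b3 c1 c2 m := u in
  4%:R * m ^+ 3 * a * b * c
  - 4%:R * m ^+ 2 * (a * b * c1 * c2 + a * c * b1 * b3 + b * c * a2 * a3)
  + 4%:R * m * (a * b * a3 * c2 ^+ 2 + a * b * b3 * c1 ^+ 2
                + a * c * a2 * b3 ^+ 2 + a * c * b1 ^+ 2 * c2
                + b * c * a2 ^+ 2 * c1 + b * c * a3 ^+ 2 * b1
                + a * b1 * b3 * c1 * c2 + b * a2 * a3 * c1 * c2
                + c * a2 * a3 * b1 * b3)
  - 12%:R * m * a * b * c * (a2 * c2 + a3 * b3 + b1 * c1)
  + (a ^+ 2 * b3 ^+ 2 * c2 ^+ 2 + b ^+ 2 * a3 ^+ 2 * c1 ^+ 2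
     + c ^+ 2 * a2 ^+ 2 * b1 ^+ 2 + a2 ^+ 2 * b3 ^+ 2 * c1 ^+ 2
     + a3 ^+ 2 * b1 ^+ 2 * c2 ^+ 2)
  - 2%:R * (a * b * a3 * b3 * c1 * c2 + a * c * a2 * b1 * b3 * c2
            + b * c * a2 * a3 * b1 * c1 + a * a2 * b3 ^+ 2 * c1 * c2
            + a * a3 * b1 * b3 * c2 ^+ 2 + b * a2 * a3 * b3 * c1 ^+ 2
            + b * a3 ^+ 2 * b1 * c1 * c2 + c * a2 * a3 * b1 ^+ 2 * c2
            + c * a2 ^+ 2 * b1 * b3 * c1 + a2 * a3 * b1 * b3 * c1 * c2)
  - 4%:R * (a * b ^+ 2 * c1 ^+ 3 + a * c ^+ 2 * b1 ^+ 3
            + a ^+ 2 * b * c2 ^+ 3 + a ^+ 2 * c * b3 ^+ 3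
            + b * c ^+ 2 * a2 ^+ 3 + b ^+ 2 * c * a3 ^+ 3
            + a * b1 * b3 ^+ 2 * c1 ^+ 2 + a * b1 ^+ 2 * c1 * c2 ^+ 2
            + b * a2 * a3 ^+ 2 * c2 ^+ 2 + b * a2 ^+ 2 * c1 ^+ 2 * c2
            + c * a2 ^+ 2 * a3 * b3 ^+ 2 + c * a3 ^+ 2 * b1 ^+ 2 * b3)
  - 6%:R * a * b * c * (a2 * b3 * c1 + a3 * b1 * c2)
  + 8%:R * (a * b * a2 * c1 * c2 ^+ 2 + a * b * b1 * c1 ^+ 2 * c2
            + a * c * a3 * b1 * b3 ^+ 2 + a * c * b1 ^+ 2 * b3 * c1
            + b * c * a2 * a3 ^+ 2 * b3 + b * c * a2 ^+ 2 * a3 * c2)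
  + 18%:R * a * b * c * (c * a2 * b1 + b * a3 * c1 + a * b3 * c2)
  - 27%:R * a ^+ 2 * b ^+ 2 * c ^+ 2.

Definition cubic_c4 u := cubic_b2 u ^+ 2 - 24%:R * cubic_b4 u.
Definition cubic_c6 u :=
  - cubic_b2 u ^+ 3 + 36%:R * cubic_b2 u * cubic_b4 u - 216%:R * cubic_b6 u.

(** Exponents are stored as data, so that the coefficient at a given monomial is a filtered sum over
    a list and computes. *)
Definition cubic_terms u : seq (K * (nat * nat * nat)) :=
  let: Cubic a b c a2 a3 b1 b3 c1 c2 m := u in
  [:: (a, (3, 0, 0)); (b, (0, 3, 0)); (c, (0, 0, 3)); (a2, (2, 1, 0));
      (a3, (2, 0, 1)); (b1, (1, 2, 0)); (b3, (0, 2, 1)); (c1, (1, 0, 2));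
      (c2, (0, 1, 2)); (m, (1, 1, 1))]%N.

Definition cubic_poly u : {mpoly K[3]} :=
  \sum_(e <- cubic_terms u) e.1 *: (let: (i, j, k) := e.2 in
    hom_x K ^+ i * hom_y K ^+ j * hom_z K ^+ k).

(** * Monomials and coefficients in three variables *)

Lemma ordinal3_ind (P : 'I_3 -> Prop) :
  P (inord 0) -> P (inord 1) -> P (inord 2) -> forall i, P i.
Proof.
by move=> P0 P1 P2 [[|[|[|//]]] lt_i3]; [move: P0|move: P1|move: P2];
  congr P; apply: val_inj; rewrite /= inordK.
Qed.

Lemma big_ord3 (V : nmodType) (F : 'I_3 -> V) :
  \sum_i F i = F (inord 0) + F (inord 1) + F (inord 2).
Proof.
rewrite !big_ord_recl big_ord0 addr0 addrA.
by congr (F _ + F _ + F _); apply: val_inj; rewrite /= inordK.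
Qed.

Definition mnm3 (i j k : nat) : 'X_{1..3} := [multinom [tuple i; j; k]].

Lemma monomial3E i j k :
  hom_x K ^+ i * hom_y K ^+ j * hom_z K ^+ k = 'X_[mnm3 i j k].
Proof.
rewrite !mpolyXn -!mpolyXD; congr 'X_[_]; apply/mnmP => l.
rewrite !mnmDE !mulmnE !mnm1E multinomE (tnth_nth 0%N) -!val_eqE /=.
elim/ordinal3_ind: l; rewrite !inordK //=; lia.
Qed.

Lemma eq_mnm3 i j k i' j' k' :
  (mnm3 i j k == mnm3 i' j' k') = ((i, j, k) == (i', j', k')).
Proof.
apply/eqP/eqP=> [|[-> -> ->] //].
by move/(congr1 (fun m : 'X_{1..3} => val (multinom_val m))) => /= [-> -> ->].
Qed.

Lemma mcoeff_cubic_poly u i j k :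
  (cubic_poly u)@_(mnm3 i j k)
  = \sum_(e <- cubic_terms u | e.2 == (i, j, k)) e.1.
Proof.
rewrite raddf_sum [RHS]big_mkcond; apply: eq_bigr => -[c [[i' j'] k']] _ /=.
rewrite mcoeffZ monomial3E mcoeffX eq_mnm3.
by case: ifP => _; rewrite ?mulr1 ?mulr0.
Qed.

(** Turns the equality of polynomials in [is_j_invariant] into an equality of records, to which the
    invariants apply. *)
Lemma cubic_poly_inj : injective cubic_poly.
Proof.
move=> u v eq_uv.
have E i j k : (cubic_poly u)@_(mnm3 i j k) = (cubic_poly v)@_(mnm3 i j k).
  by rewrite eq_uv.
move: (E 3 0 0) (E 0 3 0) (E 0 0 3) (E 2 1 0) (E 2 0 1) (E 1 2 0) (E 0 2 1)
  (E 1 0 2) (E 0 1 2) (E 1 1 1)%N => {E eq_uv}.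
rewrite !mcoeff_cubic_poly unlock.
case: u => [????????? ?]; case: v => [????????? ?] /=.
by rewrite !addr0; do 10!move=> ->.
Qed.

(** * Scaling, and cubics in Weierstrass form *)

Definition cubic_scale (c : K) u :=
  let: Cubic a b c' a2 a3 b1 b3 c1 c2 m := u in
  Cubic (c * a) (c * b) (c * c') (c * a2) (c * a3) (c * b1) (c * b3) (c * c1)
    (c * c2) (c * m).

Lemma cubic_poly_scale c u : cubic_poly (cubic_scale c u) = c *: cubic_poly u.
Proof.
rewrite /cubic_poly scaler_sumr.
have -> : cubic_terms (cubic_scale c u)
          = [seq (c * e.1, e.2) | e <- cubic_terms u] by case: u.
by rewrite big_map; apply: eq_bigr => -[c' [[i j] k]] _ /=; rewrite scalerA.
Qed.

Lemma cubic_c4_scale c u : cubic_c4 (cubic_scale c u) = c ^+ 4 * cubic_c4 u.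
Proof. by rewrite /cubic_c4 /cubic_b2 /cubic_b4; case: u => * /=; ring. Qed.

Lemma cubic_c6_scale c u : cubic_c6 (cubic_scale c u) = c ^+ 6 * cubic_c6 u.
Proof.
by rewrite /cubic_c6 /cubic_b2 /cubic_b4 /cubic_b6; case: u => * /=; ring.
Qed.

Definition weierstrass_cubic (w : weierstrass K) :=
  Cubic (-1) 0 (- wa6 w) 0 (- wa2 w) 0 1 (- wa4 w) (wa3 w) (wa1 w).

Lemma cubic_polyE u :
  let x := hom_x K in let y := hom_y K in let z := hom_z K in
  cubic_poly u =
  (c300 u)%:MP * x ^+ 3 + (c030 u)%:MP * y ^+ 3 + (c003 u)%:MP * z ^+ 3
  + (c210 u)%:MP * (x ^+ 2 * y) + (c201 u)%:MP * (x ^+ 2 * z)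
  + (c120 u)%:MP * (x * y ^+ 2) + (c021 u)%:MP * (y ^+ 2 * z)
  + (c102 u)%:MP * (x * z ^+ 2) + (c012 u)%:MP * (y * z ^+ 2)
  + (c111 u)%:MP * (x * y * z).
Proof.
rewrite /= /cubic_poly unlock.
case: u => a b c a2 a3 b1 b3 c1 c2 m /=; rewrite -!mul_mpolyC.
move: (hom_x K) (hom_y K) (hom_z K) a%:MP b%:MP c%:MP a2%:MP a3%:MP b1%:MP
  b3%:MP c1%:MP c2%:MP m%:MP => *.
ring.
Qed.

Lemma weierstrass_cubicP w :
  cubic_poly (weierstrass_cubic w) = weierstrass_poly w.
Proof.
rewrite cubic_polyE /weierstrass_poly /= -!mul_mpolyC !mpolyCN mpolyC1 mpolyC0.
move: (hom_x K) (hom_y K) (hom_z K) (wa1 w)%:MP (wa2 w)%:MP (wa3 w)%:MP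
  (wa4 w)%:MP (wa6 w)%:MP => *.
ring.
Qed.

Lemma cubic_c4_weierstrass w : cubic_c4 (weierstrass_cubic w) = wc4 w.
Proof. by rewrite /cubic_c4 /cubic_b2 /cubic_b4 /wc4 /wb2 /wb4 /=; ring. Qed.

(** The classical relation between discriminant, c4 and c6. It ties [wdisc], defined for Weierstrass
    equations only, to invariants of arbitrary cubics. *)
Lemma wdisc_c4_c6 w :
  1728%:R * wdisc w = wc4 w ^+ 3 - cubic_c6 (weierstrass_cubic w) ^+ 2.
Proof.
rewrite /cubic_c6 /cubic_b2 /cubic_b4 /cubic_b6 /wdisc /wc4 /wb2 /wb4 /wb6.
by rewrite /wb8 /=; ring.
Qed.

(** * Linear substitutions in the Hessian cubic *)

Definition hesse_cubic (b : K) := Cubic 1 1 1 0 0 0 0 0 0 (- (3%:R * b)).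

Definition entry (A : 'M[K]_3) (i j : nat) := A (inord i) (inord j).

(* Coefficients of the substitution of A in the Hessian cubic: f is the value
   of the cubic at a column of A, and g its derivative at one column in the
   direction of another. *)
Definition hesse_subst (b : K) (A : 'M[K]_3) :=
  let p := entry A 0 0 in let q := entry A 0 1 in let r := entry A 0 2 in
  let s := entry A 1 0 in let t := entry A 1 1 in let o := entry A 1 2 in
  let h := entry A 2 0 in let k := entry A 2 1 in let n := entry A 2 2 in
  let f x y z := x ^+ 3 + y ^+ 3 + z ^+ 3 - 3%:R * b * x * y * z in
  let g x y z x' y' z' :=
    3%:R * (x ^+ 2 * x' + y ^+ 2 * y' + z ^+ 2 * z')
    - 3%:R * b * (x' * y * z + x * y' * z + x * y * z') in
  Cubic (f p s h) (f q t k) (f r o n) (g p s h q t k) (g p s h r o n)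
    (g q t k p s h) (g q t k r o n) (g r o n p s h) (g r o n q t k)
    (6%:R * (p * q * r + s * t * o + h * k * n)
     - 3%:R * b * (p * t * n + p * o * k + q * s * n + q * o * h
                   + r * s * k + r * t * h)).

Lemma linear_substE (A : 'M[K]_3) i :
  (linear_subst A)`_(inord i : 'I_3) =
  (entry A i 0)%:MP * hom_x K + (entry A i 1)%:MP * hom_y K
  + (entry A i 2)%:MP * hom_z K.
Proof. by rewrite -tnth_nth tnth_mktuple big_ord3 !mul_mpolyC. Qed.

(** Stated for any ring and morphism, so that [ring] sees the coordinates as atoms; it is applied to
    the embedding of constants into polynomials. *)
Lemma hesse_subst_eval (R : comNzRingType) (f : {rmorphism K -> R}) b A
    (x y z : R) :
  let l i := f (entry A i 0) * x + f (entry A i 1) * y + f (entry A i 2) * z in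
  let u := hesse_subst b A in
  l 0%N ^+ 3 + l 1%N ^+ 3 + l 2%N ^+ 3
  - f (3%:R * b) * (l 0%N * l 1%N * l 2%N) =
  f (c300 u) * x ^+ 3 + f (c030 u) * y ^+ 3 + f (c003 u) * z ^+ 3
  + f (c210 u) * (x ^+ 2 * y) + f (c201 u) * (x ^+ 2 * z)
  + f (c120 u) * (x * y ^+ 2) + f (c021 u) * (y ^+ 2 * z)
  + f (c102 u) * (x * z ^+ 2) + f (c012 u) * (y * z ^+ 2)
  + f (c111 u) * (x * y * z).
Proof. by rewrite /=; ring. Qed.

Lemma hesse_substP b A :
  hessian_cubic b \mPo linear_subst A = cubic_poly (hesse_subst b A).
Proof.
rewrite /hessian_cubic comp_mpolyB comp_mpolyZ !comp_mpolyD.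
rewrite !(rmorphXn, rmorphM) /= !comp_mpolyXU !linear_substE.
rewrite -mul_mpolyC cubic_polyE.
exact: (hesse_subst_eval (@mpolyC 3 K)).
Qed.

Lemma det3 (A : 'M[K]_3) :
  \det A =
    entry A 0 0 * (entry A 1 1 * entry A 2 2 - entry A 1 2 * entry A 2 1)
    - entry A 0 1 * (entry A 1 0 * entry A 2 2 - entry A 1 2 * entry A 2 0)
    + entry A 0 2 * (entry A 1 0 * entry A 2 1 - entry A 1 1 * entry A 2 0).
Proof.
have {1}-> : A = \matrix_(i, j) entry A i j.
  by apply/matrixP => i j; rewrite mxE /entry !inord_val.
do ![rewrite (expand_det_row _ ord0) !big_ord_recl big_ord0 /cofactor].
rewrite !det_mx00 !mxE /= /bump /=.
ring.
Qed.

Lemma hesse_subst_c4 b A :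
  cubic_c4 (hesse_subst b A) = \det A ^+ 4 * cubic_c4 (hesse_cubic b).
Proof.
rewrite det3 /cubic_c4 /cubic_b2 /cubic_b4 /=.
(* The entries become free variables, which leaves a polynomial identity. *)
do 9!(match goal with
  |- context [entry A ?i ?j] => move: (entry A i j) => ? end).
ring.
Qed.

Lemma hesse_subst_c6 b A :
  cubic_c6 (hesse_subst b A) = \det A ^+ 6 * cubic_c6 (hesse_cubic b).
Proof.
rewrite det3 /cubic_c6 /cubic_b2 /cubic_b4 /cubic_b6 /=.
do 9!(match goal with
  |- context [entry A ?i ?j] => move: (entry A i j) => ? end).
ring.
Qed.

(** * The j-invariant of the Hessian cubic *)

Lemma hesse_c4 b : cubic_c4 (hesse_cubic b) = 3%:R ^+ 4 * b * (b ^+ 3 + 8%:R).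
Proof. by rewrite /cubic_c4 /cubic_b2 /cubic_b4 /=; ring. Qed.

Lemma hesse_c6 b :
  cubic_c6 (hesse_cubic b) = - 3%:R ^+ 6 * (b ^+ 6 - 20%:R * b ^+ 3 - 8%:R).
Proof. by rewrite /cubic_c6 /cubic_b2 /cubic_b4 /cubic_b6 /=; ring. Qed.

Definition hesse_j (b : K) :=
  27%:R * b ^+ 3 * (b ^+ 3 + 8%:R) ^+ 3 / (b ^+ 3 - 1) ^+ 3.

(** Comparing c4 and c6 before and after the substitution determines [c ^+ 4 * wc4 w] and
    [c ^+ 12 * wdisc w]; the powers of [c] and of [\det A] cancel in the quotient
    [weierstrass_j w]. *)
Lemma hesse_j_uniq b j :
  6%:R != 0 :> K -> b ^+ 3 != 1 -> is_j_invariant (hessian_cubic b) j ->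
  j = hesse_j b.
Proof.
move=> n6 b3 [w [A [c [A_unit c0 D0 FE ->]]]].
move: FE; rewrite hesse_substP -weierstrass_cubicP -cubic_poly_scale.
move/cubic_poly_inj => FE.
have c4E : c ^+ 4 * wc4 w = \det A ^+ 4 * (3%:R ^+ 4 * b * (b ^+ 3 + 8%:R)).
  by rewrite -hesse_c4 -hesse_subst_c4 FE cubic_c4_scale cubic_c4_weierstrass.
have c6E : c ^+ 6 * cubic_c6 (weierstrass_cubic w)
    = \det A ^+ 6 * (- 3%:R ^+ 6 * (b ^+ 6 - 20%:R * b ^+ 3 - 8%:R)).
  by rewrite -hesse_c6 -hesse_subst_c6 FE cubic_c6_scale.
have := wdisc_c4_c6 w.
rewrite unitmxE unitfE in A_unit.
rewrite -subr_eq0 in b3.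
have n2 : 2%:R != 0 :> K.
  by apply: contraNneq n6 => e; rewrite (natrM _ 2 3) e mul0r.
have n3 : 3%:R != 0 :> K.
  by apply: contraNneq n6 => e; rewrite (natrM _ 2 3) e mulr0.
move: (cubic_c6 _) c6E => c6 c6E DE.
(* With t = b^3, t (t + 8)^3 - (t^2 - 20 t - 8)^2 = 64 (t - 1)^3. *)
have DE' : c ^+ 12 * (1728%:R * wdisc w)
    = \det A ^+ 12 * (3%:R ^+ 12 * 64%:R * (b ^+ 3 - 1) ^+ 3).
  have -> : c ^+ 12 * (1728%:R * wdisc w)
            = (c ^+ 4 * wc4 w) ^+ 3 - (c ^+ 6 * c6) ^+ 2.
    by rewrite DE; ring.
  by rewrite c4E c6E; ring.
rewrite /weierstrass_j /hesse_j.
apply/eqP; rewrite eqr_div ?expf_neq0 //; apply/eqP.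
(* Multiplying by this factor lets [c4E] and [DE'] rewrite the cross-multiplied equation. *)
have nz : c ^+ 12 * 1728%:R * (\det A ^+ 12 * (3%:R ^+ 12 * 64%:R)) != 0.
  rewrite (natrM _ (2 ^ 6) (3 ^ 3)) (natrX _ 2 6) !natrX.
  by rewrite !(mulf_neq0, expf_neq0).
apply: (mulfI nz).
transitivity (1728%:R * (c ^+ 4 * wc4 w) ^+ 3
  * (\det A ^+ 12 * (3%:R ^+ 12 * 64%:R * (b ^+ 3 - 1) ^+ 3))); first by ring.
by rewrite -DE' c4E; ring.
Qed.

Lemma hesse_j_exists (b : K) :
  6%:R != 0 :> K -> b ^+ 3 != 1 ->
  is_j_invariant (hessian_cubic b) (hesse_j b).
Proof.
move=> n6 b3; have := b3; rewrite -subr_eq0 => b3'.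
have n3 : 3%:R != 0 :> K.
  by apply: contraNneq n6 => e; rewrite (natrM _ 2 3) e mulr0.
(* A sends (0 : 1 : 0) to the flex (1 : -1 : 0) and the line at infinity to the
   flex tangent x + y + b z = 0. *)
pose k := (b ^+ 3 - 1) / 3%:R.
pose w := Weierstrass b (- b ^+ 2) (- k) (b * k) (- k ^+ 2 / 3%:R).
pose A : 'M[K]_3 := \matrix_(i, j)
  nth 0 (nth [::] [:: [:: 0; 1; 0]; [:: - b; -1; k]; [:: 1; 0; 0]] i) j.
have discE : wdisc w = k ^+ 3.
  by rewrite /wdisc /wb2 /wb4 /wb6 /wb8 /w /k /=; field.
have n9 : k != 0 by rewrite mulf_neq0 ?invr_neq0.
(* By uniqueness, any nonsingular model has the required j-invariant. *)
suff jE : is_j_invariant (hessian_cubic b) (weierstrass_j w).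
  by rewrite -(hesse_j_uniq n6 b3 jE).
have entryE i j : (i < 3)%N -> (j < 3)%N -> entry A i j =
    nth 0 (nth [::] [:: [:: 0; 1; 0]; [:: - b; -1; k]; [:: 1; 0; 0]] i) j.
  by move=> lt_i lt_j; rewrite /entry mxE !inordK.
(* After the substitution Y^2 Z has coefficient 3k = b^3 - 1 and X^3 has 1 - b^3: the choice of [k]
   makes them opposite. *)
exists w, A, (b ^+ 3 - 1); split=> //.
- rewrite unitmxE unitfE det3 !entryE //=.
  by rewrite [X in X != 0](_ : _ = k) //; ring.
- by rewrite discE expf_neq0.
rewrite hesse_substP -weierstrass_cubicP -cubic_poly_scale; congr cubic_poly.
rewrite /hesse_subst !entryE //= /k; congr Cubic; by field.
Qed.

(** * Nonsingularity of the Hessian cubic *)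

Lemma meval_mderiv_hessian (L : fieldType) (f : {rmorphism K -> L})
    (v : 'I_3 -> L) (b : K) (i : 'I_3) :
  let x := v (inord 0) in let y := v (inord 1) in let z := v (inord 2) in
  let d j : L := (inord j == i)%:R in
  (map_mpoly f (hessian_cubic b)^`M(i)).@[v]
  = 3%:R * (d 0%N * (x ^+ 2 - f b * y * z) + d 1%N * (y ^+ 2 - f b * x * z)
            + d 2%N * (z ^+ 2 - f b * x * y)).
Proof.
(* [D] is a derivation relative to the evaluation [g], so the rules below reduce it to its values on
   the variables. *)
pose g p : L := (map_mpoly f p).@[v]; pose D p := g p^`M(i).
have gM p q : g (p * q) = g p * g q by rewrite /g rmorphM mevalM.
have gX j : g 'X_j = v j by rewrite /g map_mpolyX mevalXU.
have DM p q : D (p * q) = D p * g q + g p * D q.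
  by rewrite /D mderivM {1}/g rmorphD mevalD -!/(g _) !gM.
have DD p q : D (p + q) = D p + D q.
  by rewrite /D mderivD {1}/g rmorphD mevalD.
have DB p q : D (p - q) = D p - D q.
  by rewrite /D mderivB {1}/g rmorphB mevalB.
have DZ c p : D (c *: p) = f c * D p.
  by rewrite /D mderivZ {1}/g map_mpolyZ mevalZ.
have DX j : D 'X_j = (j == i)%:R.
  rewrite /D mderivX mnm1E /g map_mpolyZ mevalZ rmorph_nat.
  case: eqP => [->|_]; last by rewrite mul0r.
  have -> : (U_(i) - U_(i))%MM = 0%MM.
    by apply/mnmP => k; rewrite mnmBE subnn mnm0E.
  by rewrite mpolyX0 !rmorph1 mulr1.
move=> x y z d; rewrite -/(g _) -/(D _) /hessian_cubic /hom_x /hom_y /hom_z.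
rewrite !exprSr !expr0 !mul1r DB !DD DZ !DM !gM !gX !DX.
rewrite -/x -/y -/z -/(d 0%N) -/(d 1%N) -/(d 2%N).
by rewrite rmorphM rmorph_nat; ring.
Qed.

(** At a singular point x^2 = b y z, and likewise for y and z. The product of the three gives (b^3 -
    1) (x y z)^2 = 0, so one coordinate vanishes, and then all do. *)
Lemma hessian_nonsingular (b : K) :
  3%:R != 0 :> K -> b ^+ 3 != 1 -> nonsingular (hessian_cubic b).
Proof.
move=> n3 b3 L f v [i0 vi0] _.
pose x := v (inord 0); pose y := v (inord 1); pose z := v (inord 2).
have n3' : 3%:R != 0 :> L by rewrite -(rmorph_nat f) fmorph_eq0.
have fb3 : f b ^+ 3 != 1 by rewrite -rmorphXn fmorph_eq1.
have neq_inord : [/\ inord 0 != inord 1 :> 'I_3, inord 0 != inord 2 :> 'I_3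
                  & inord 1 != inord 2 :> 'I_3].
  by rewrite -!val_eqE /= !inordK.
case: neq_inord => /negPf n01 /negPf n02 /negPf n12.
have dE i := meval_mderiv_hessian f v b i.
apply/existsP; rewrite -[X in is_true X]negbK; apply/negP => /existsPn crit.
have crit0 i : (map_mpoly f (hessian_cubic b)^`M(i)).@[v] = 0.
  by apply/eqP; rewrite -[_ == _]negbK.
have {crit} [xE yE zE] : [/\ x ^+ 2 = f b * y * z, y ^+ 2 = f b * x * z
                           & z ^+ 2 = f b * x * y].
  move: (crit0 (inord 0)) (crit0 (inord 1)) (crit0 (inord 2)).
  rewrite !dE !eqxx n01 n02 n12 [inord 1 == inord 0]eq_sym.
  rewrite [inord 2 == inord 0]eq_sym [inord 2 == inord 1]eq_sym n01 n02 n12.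
  rewrite !mul0r !mul1r !addr0 !add0r -/x -/y -/z.
  by split; apply/eqP; rewrite -subr_eq0 -(mulrI_eq0 _ (mulfI n3')); apply/eqP.
have xyz0 : x * y * z = 0.
  have : (f b ^+ 3 - 1) * (x * y * z) ^+ 2 = 0.
    have -> : (x * y * z) ^+ 2 = x ^+ 2 * y ^+ 2 * z ^+ 2 by ring.
    rewrite mulrBl mul1r {2}xE {2}yE {2}zE.
    by ring: xE yE zE.
  by move/eqP; rewrite mulf_eq0 subr_eq0 (negPf fb3) expf_eq0 => /eqP.
have v0 : [/\ x = 0, y = 0 & z = 0].
  have sq0 (t : L) : t ^+ 2 = 0 -> t = 0 by move/eqP; rewrite expf_eq0 => /eqP.
  move/eqP: xyz0; rewrite !mulf_eq0 -orbA => /or3P[] /eqP t0.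
  - by split=> //; apply: sq0; rewrite ?yE ?zE t0; ring.
  - by split=> //; apply: sq0; rewrite ?xE ?zE t0; ring.
  - by split=> //; apply: sq0; rewrite ?xE ?yE t0; ring.
have : v i0 = 0 by elim/ordinal3_ind: i0 {vi0}; case: v0.
by move/eqP; rewrite (negPf vi0).
Qed.

End PlaneCubicInvariants.

(** * Roots in finite fields *)

Section FiniteField.
Variable K : finFieldType.

(** The [n] nonzero elements are distinct [n]-th roots of unity, enough to force a primitive one. *)
Lemma finField_prim_root n : #|K| = n.+1 -> exists z : K, n.-primitive_root z.
Proof.
move=> cardK; pose rs := enum (predC1 (0 : K)).
have n_gt0 : (0 < n)%N by have := finNzRing_gt1 K; rewrite cardK.
have size_rs : size rs = n by rewrite -cardE cardC1 cardK.
have unity : all n.-unity_root rs.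
  apply/allP => x; rewrite mem_enum unity_rootE => x0.
  by apply/eqP/(mulIf x0); rewrite -exprSr -cardK expf_card mul1r.
have := cyclic.has_prim_root n_gt0 unity.
rewrite enum_uniq size_rs leqnn => /(_ isT isT) /hasP[z _ zP].
by exists z.
Qed.

(** Write t = z^i for a generator z; t^e = 1 means that d e divides i e, so d divides i. *)
Lemma finField_root d e (t : K) :
  #|K| = (d * e).+1 -> t ^+ e = 1 -> exists b, b ^+ d = t.
Proof.
move=> cardK te; have [z zP] := finField_prim_root cardK.
have := prim_order_gt0 zP; rewrite muln_gt0 => /andP[d0 e0].
have tde : t ^+ (d * e) = 1 by rewrite mulnC exprM te expr1n.
have [i tE] := prim_rootP zP tde.
have : (d %| i)%N.
  by rewrite -(dvdn_pmul2r e0) (prim_order_dvd zP) exprM -tE te.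
by case/dvdnP => k iE; exists (z ^+ k); rewrite -exprM -iE tE.
Qed.

End FiniteField.

(** * Arithmetic in the field with p^2 elements *)

Section Characteristic.
Variables (p : nat) (K : finFieldType).
Hypotheses (p_prime : prime p) (cardK : #|K| = (p ^ 2)%N).
Hypotheses (p3 : p = 2 %[mod 3]) (p_odd : odd p).
Let m := ((p + 1) %/ 3)%N.
Let pK : p \in [pchar K] := card_finPcharP cardK p_prime.

Lemma p_add1E : (p + 1 = 3 * m)%N.
Proof. rewrite /m; have := p3; lia. Qed.

Lemma m_even : ~~ odd m.
Proof. have := p_add1E; have := p_odd; lia. Qed.

Lemma natr_expp n : n%:R ^+ p = n%:R :> K.
Proof. by rewrite -(pFrobenius_autE pK) rmorph_nat. Qed.

Lemma exprDp (x y : K) : (x + y) ^+ p = x ^+ p + y ^+ p.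
Proof. exact: (GRing.pFrobenius_autD_comm pK (mulrC x y)). Qed.

Lemma natr_neq0 n : (0 < n < p)%N -> n%:R != 0 :> K.
Proof.
case/andP => n0 np; rewrite -(dvdn_pcharf pK); apply/negP => /(dvdn_leq n0).
by rewrite leqNgt np.
Qed.

Lemma cube_inj (x y : K) : x ^+ p = x -> y ^+ p = y -> x ^+ 3 = y ^+ 3 -> x = y.
Proof.
(* Since 3e + 1 = 2p, (t^3)^e t = t^(2p) = t^2 whenever t^p = t: the power [e] inverts cubing. *)
pose e := (m + (m - 1))%N.
have p_gt1 := prime_gt1 p_prime.
have eE : (3 * e + 1 = p + p)%N by rewrite /e; have := p_add1E; lia.
have e_gt0 : (0 < e)%N by lia.
have cubeK (t : K) : t ^+ p = t -> (t ^+ 3) ^+ e = t.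
  move=> tp; have [->|t0] := eqVneq t 0.
    by rewrite -exprM expr0n muln_eq0 (gtn_eqF e_gt0).
  by apply: (mulIf t0); rewrite -exprM -exprSr -addn1 eE exprD tp.
by move=> xp yp xy; rewrite -(cubeK x xp) -(cubeK y yp) xy.
Qed.

Let c : K := (cbrt (2%:R : 'F_p) : nat)%:R.

Lemma cbrt2_cube : c ^+ 3 = 2%:R.
Proof.
have rE : (cbrt (2%:R : 'F_p)) ^+ 3 = 2%:R by apply/(cbrtP _ p_prime p3).
(* The equation in ['F_p] is a congruence mod p between representatives, which casts to an equation
   in [K]. *)
have := congr1 (@nat_of_ord _) rE; rewrite -[in LHS](natr_Zp (cbrt _)) -natrX.
rewrite !val_Fp_nat // => E.
by rewrite /c -natrX -(GRing.natr_mod_pchar pK) E (GRing.natr_mod_pchar pK).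
Qed.

Lemma exp4m : 4%:R ^+ m = 2%:R * c.
Proof.
(* The cubes agree: 4^(3m) = 4^(p+1) = 16 = (2c)^3. *)
apply: cube_inj.
- by rewrite -exprM mulnC exprM natr_expp.
- by rewrite exprMn natr_expp natr_expp.
rewrite -exprM mulnC -p_add1E exprD natr_expp expr1 exprMn cbrt2_cube.
by ring.
Qed.

Lemma p_gt3 : (3 < p)%N.
Proof. by move: p3 p_odd; case: p p_prime => [|[|[|[|]]]]. Qed.

Let n2 : 2%:R != 0 :> K.
Proof. by apply: natr_neq0; have := p_gt3; lia. Qed.
Let n3 : 3%:R != 0 :> K.
Proof. by apply: natr_neq0; have := p_gt3; lia. Qed.
Let n6 : 6%:R != 0 :> K.
Proof. by rewrite (natrM _ 2 3) mulf_neq0. Qed.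

(** As 3 divides p + 1, b^3 = 1 would give 1 = -2. Hence every curve of the family is
    nonsingular. *)
Lemma cube_neq1 (b : K) : b ^+ (p + 1) = - 2%:R -> b ^+ 3 != 1.
Proof.
move=> bp; apply: contraNneq n3 => b3; apply/eqP.
move: bp; rewrite p_add1E exprM b3 expr1n => /eqP; rewrite -subr_eq0 => /eqP <-.
by ring.
Qed.

(** * Both sets of j-invariants in terms of b *)

Lemma hessian_jP (j : K) :
  hessian_j p j <-> exists2 b : K, b ^+ (p + 1) = - 2%:R & j = hesse_j b.
Proof.
split=> [[b [bp _ jP]]|[b bp ->]]; exists b; rewrite ?bp //.
  by apply: hesse_j_uniq jP => //; apply: cube_neq1.
split=> //; last exact/hesse_j_exists/cube_neq1.
exact/hessian_nonsingular/cube_neq1.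
Qed.

Lemma hesse_j_param (a b : K) : a != 0 -> b ^+ 3 = - 4%:R / a -> b ^+ 3 != 1 ->
  hesse_j b
  = 3%:R ^+ 3 * 4%:R ^+ 4 * (2%:R * a - 1) ^+ 3 / (a * (a + 4%:R) ^+ 3).
Proof.
move=> a0 b3; rewrite /hesse_j b3 => ab.
(* The value a = -4 corresponds to b^3 = 1. *)
have a4 : a + 4%:R != 0.
  apply: contraNneq ab => e; rewrite -(addrK 4%:R a) e sub0r divff //.
  by rewrite oppr_eq0 (natrM _ 2 2) mulf_neq0.
by field; rewrite a4 a0 mulN1r -opprD oppr_eq0 addrC.
Qed.

Lemma param_jP (j : K) :
  param_j p j <-> exists2 b : K, b ^+ (p + 1) = - 2%:R & j = hesse_j b.
Proof.
have c0 : c != 0.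
  by apply: contraNneq n2 => e; rewrite -cbrt2_cube e expr0n.
have n4 : 4%:R != 0 :> K by rewrite (natrM _ 2 2) mulf_neq0.
have signm : (-1) ^+ m = 1 :> K by rewrite -signr_odd (negPf m_even).
have n4m : (- 4%:R) ^+ m = 2%:R * c by rewrite exprNn signm mul1r exp4m.
have m0 : (0 < m)%N by have := p_add1E; case: m => //; rewrite addn1.
split=> [[a [ap ->]]|[b bp ->]].
  have {}ap : a ^+ m = - c by apply/eqP; rewrite -addr_eq0; apply/eqP.
  have a0 : a != 0.
    apply: contraNneq c0 => a0.
    by rewrite -oppr_eq0 -ap a0 expr0n eqn0Ngt m0.
  have tm : (- 4%:R / a) ^+ m = - 2%:R.
    by rewrite expr_div_n n4m ap invrN mulrN mulfK.
  have [b b3] : exists b, b ^+ 3 = - 4%:R / a.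
    (* Here p^2 - 1 = 3 m (p - 1), and t = -4/a satisfies t^(m(p-1)) = (-2)^(p-1) = 1. *)
    apply: (@finField_root K 3 (m * (p - 1))).
      rewrite cardK mulnA -p_add1E mulnC -(subn_sqr p 1) exp1n subn1 prednK //.
      by rewrite expn_gt0 prime_gt0.
    rewrite exprM tm.
    apply: (mulIf (_ : - 2%:R != 0)); first by rewrite oppr_eq0.
    rewrite -exprSr subn1 prednK ?prime_gt0 // mul1r exprNn natr_expp.
    by rewrite -signr_odd p_odd mulN1r.
  exists b; first by rewrite p_add1E exprM b3.
  symmetry; apply: hesse_j_param => //; apply: cube_neq1.
  by rewrite p_add1E exprM b3.
have b0 : b != 0.
  by apply: contraNneq n2 => b0; rewrite -oppr_eq0 -bp b0 addn1 expr0n.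
have b3 := cube_neq1 bp.
exists (- 4%:R / b ^+ 3); split.
  rewrite -/m expr_div_n n4m -exprM -p_add1E bp -/c; field.
  by rewrite oppr_eq0.
apply: hesse_j_param => //.
  by rewrite mulf_neq0 ?oppr_eq0 ?invr_eq0 ?expf_neq0.
by field; rewrite oppr_eq0 n4 b0.
Qed.

(** * The values 0 and 1728 *)

Lemma hesse_j_neq0 (b : K) : b ^+ (p + 1) = - 2%:R -> hesse_j b != 0.
Proof.
move=> bp; have b3 := cube_neq1 bp.
have b0 : b != 0.
  by apply: contraNneq n2 => b0; rewrite -oppr_eq0 -bp b0 addn1 expr0n.
have b8 : b ^+ 3 + 8%:R != 0.
  apply: contraNneq n6 => /eqP; rewrite addr_eq0 => /eqP b8; apply/eqP.
  (* As [m] is even, this is 2^(3m) = 2^(p+1) = 4. *)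
  have E : (- 8%:R) ^+ m = 4%:R :> K.
    rewrite exprNn -signr_odd (negPf m_even) mul1r (natrX _ 2 3).
    by rewrite -exprM -p_add1E addn1 exprS natr_expp -natrM.
  have : 4%:R = - 2%:R :> K by rewrite -E -b8 -exprM -p_add1E.
  by move/eqP; rewrite -subr_eq0 => /eqP <-; ring.
have n27 : 27%:R != 0 :> K by rewrite (natrM _ 3 9) (natrM _ 3 3) !mulf_neq0.
by rewrite /hesse_j !mulf_neq0 ?invr_eq0 ?expf_neq0 ?subr_eq0.
Qed.

Lemma sqrt3_expp : p = 3 %[mod 4] -> exists2 s : K, s ^+ 2 = 3%:R & s ^+ p = s.
Proof.
move=> p4.
have cardK' : #|K| = ((p ^ 2).-1).+1.
  by rewrite cardK prednK // expn_gt0 prime_gt0.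
have [z zP] := finField_prim_root cardK'.
(* Already p + 1 is divisible by 12. *)
have d12 : (12 %| (p ^ 2).-1)%N.
  by rewrite -subn1 -(exp1n 2) subn_sqr dvdn_mull //; move: p3 p4; clear; lia.
have d3 : (3 %| (p ^ 2).-1)%N by apply: dvdn_trans d12.
have d4 : (4 %| (p ^ 2).-1)%N by apply: dvdn_trans d12.
move: (dvdn_prim_root zP d3) (dvdn_prim_root zP d4).
move: (z ^+ _) (z ^+ _) => i w wP iP.
(* 3 = (i (2w + 1))^2 for i, w primitive roots of unity of order 4 and 3. *)
have i2 : i ^+ 2 = -1.
  have : i ^+ 2 != 1 by rewrite -(prim_order_dvd iP).
  have /eqP := prim_expr_order iP; rewrite (exprM i 2 2) sqrf_eq1.
  by move=> /orP[->//|/eqP].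
have w2 : w ^+ 2 = - w - 1.
  have w1 : w - 1 != 0 by rewrite subr_eq0 -(expr1 w) -(prim_order_dvd wP).
  apply/eqP; rewrite -subr_eq0; apply/eqP/(mulfI w1); rewrite mulr0.
  transitivity (w ^+ 3 - 1); first by ring.
  by rewrite (prim_expr_order wP) subrr.
exists (i * (2%:R * w + 1)).
  by rewrite exprMn i2; ring: w2.
(* Frobenius sends i to i^3 = -i and w to w^2 = -w - 1, so it negates both i and 2w + 1; the signs
   cancel. *)
rewrite exprMn -(expr_mod p (prim_expr_order iP)) p4 exprDp exprMn.
rewrite natr_expp expr1n -(expr_mod p (prim_expr_order wP)) p3 exprS i2.
by ring: w2.
Qed.

Lemma hesse_j_neq1728 (b : K) : p = 3 %[mod 4] ->
  b ^+ (p + 1) = - 2%:R -> hesse_j b != 1728%:R.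
Proof.
move=> p4 bp; have b3 := cube_neq1 bp; have [s s2 sp] := sqrt3_expp p4.
apply/eqP => jE; have n27 : 27%:R != 0 :> K.
  by rewrite (natrM _ 3 9) (natrM _ 3 3) !mulf_neq0.
(* With t = b^3, 27 t (t + 8)^3 - 1728 (t - 1)^3 = 27 (t^2 - 20 t - 8)^2, and the roots of this
   quadratic are 10 + 6s and 10 - 6s. *)
have : 27%:R * ((b ^+ 3 - (1 + s) ^+ 3) * (b ^+ 3 - (1 - s) ^+ 3)) ^+ 2 = 0.
  have b3' : (b ^+ 3 - 1) ^+ 3 != 0 by rewrite expf_neq0 // subr_eq0.
  have {}jE : 27%:R * b ^+ 3 * (b ^+ 3 + 8%:R) ^+ 3
              = 1728%:R * (b ^+ 3 - 1) ^+ 3 by rewrite -jE divfK.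
  have -> : (b ^+ 3 - (1 + s) ^+ 3) * (b ^+ 3 - (1 - s) ^+ 3)
            = b ^+ 6 - 20%:R * b ^+ 3 - 8%:R.
    have -> : (1 + s) ^+ 3 = 10%:R + 6%:R * s by ring: s2.
    have -> : (1 - s) ^+ 3 = 10%:R - 6%:R * s by ring: s2.
    by ring: s2.
  move/eqP: jE; rewrite -subr_eq0 => /eqP <-; ring.
move/eqP; rewrite mulf_eq0 (negPf n27) expf_eq0 mulf_eq0 !subr_eq0 /=.
have absurd (u : K) : (u - 1) ^+ 2 = 3%:R -> u ^+ p = u -> b ^+ 3 <> u ^+ 3.
  move=> u3 up bu.
  have u2 : u ^+ 2 = - 2%:R.
    by rewrite expr2 -{1}up -exprSr -addn1 -bp p_add1E exprM -bu -exprM.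
  (* From u^2 - 2u = 2 and u^2 = -2 follows u = -2; then 4 = -2, that is 6 = 0. *)
  have uE : u = - 2%:R.
    apply: (mulfI n2); move/eqP: u3; rewrite -subr_eq0 => /eqP u3.
    by rewrite -[RHS]subr0 -u3; ring: u2.
  move/eqP: u2; rewrite -subr_eq0 uE => /eqP u2.
  by case/eqP: n6; rewrite -u2; ring.
case/orP => /eqP; apply: absurd.
- by rewrite addrC addKr.
- by rewrite exprDp expr1n sp.
- by rewrite addrC addKr sqrrN.
- by rewrite exprDp expr1n exprNn sp -signr_odd p_odd mulN1r.
Qed.

End Characteristic.

Theorem proposition1p12 (p : nat) (p_prime : prime p)
    (p_mod12 : p = 5 %[mod 12] \/ p = 11 %[mod 12])
    (K : finFieldType) (cardK : #|K| = (p ^ 2)%N) :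
  (p = 11 %[mod 12] -> forall j : K,
     (param_j p j /\ j <> 0 /\ j <> 1728%:R) <-> hessian_j p j) /\
  (p = 5 %[mod 12] -> forall j : K,
     (param_j p j /\ j <> 0 /\ j <> 1728%:R) <->
     (hessian_j p j /\ j <> 1728%:R)).
Proof.
have p3 : p = 2 %[mod 3] by case: p_mod12; lia.
have p_odd : odd p by case: p_mod12; lia.
have hessianE := hessian_jP p_prime cardK p3 p_odd.
have paramE j := iff_trans (param_jP p_prime cardK p3 p_odd j)
                           (iff_sym (hessianE j)).
have neq0 j : hessian_j p j -> j <> 0 :> K.
  by case/hessianE => b bp ->; apply/eqP/(hesse_j_neq0 p_prime cardK).
split=> p12 j.
  have p4 : p = 3 %[mod 4] by lia.
  split=> [[/paramE]|jP] //; split; first exact/paramE.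
  split; first exact: neq0.
  by case/hessianE: jP => b bp ->; apply/eqP/(hesse_j_neq1728 p_prime cardK).
split=> [[/paramE jP [_ j1728]] //|[jP j1728]].
by split; [exact/paramE|split; [exact: neq0|]].
Qed.
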